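(* Let $C_T$ be a clique tree of order $n$ with $s$ cliques such that some two cut vertices of $C_T$ are not adjacent. Let $\mathbb{S}(s-2,1)$ be the clique tree obtained from $C_T$ as described in the context. Then $$\lambda_1(A(C_T^c))\le \lambda_1(A(\mathbb{S}^c(s-2,1))).$$
   Context: All graphs are finite and simple. A cut vertex of a connected graph is a vertex whose deletion disconnects the graph. A block is a maximal connected subgraph having no cut vertex. A clique tree is a connected graph each of whose blocks is a clique (a complete graph); its blocks are called its cliques. For a graph $G$, $G^c$ denotes its complement, $A(G)$ its adjacency matrix and $\lambda_1(A(G))$ the largest eigenvalue of $A(G)$ (the spectral radius). The clique tree $\mathbb{S}(s-2,1)$ is obtained from $C_T$ as follows: choose a clique $K$ of $C_T$ containing two cut vertices $w$ and $w'$, and a clique $K'\neq K$ containing $w'$; then rearrange the cliques of $C_T$ (keeping the orders of all cliques) so that the resulting clique tree, on $n$ vertices with $s$ cliques, has exactly two cut vertices $w$ and $w'$, the clique $K$ contains both $w$ and $w'$, $K'$ is an end clique attached at $w'$ (and is the only clique other than $K$ containing $w'$), and all the remaining $s-2$ cliques are end cliques attached at $w$. Here an end clique is a clique containing exactly one cut vertex.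
   Formalization: The inequality fails for some choices of K, w, w', K' in the construction; what is proved is that there is a cut vertex w, lying in a clique with another cut vertex, such that it holds for all admissible w', K, K' and every resulting S(s-2,1). *)

(* Defs.v *)
From mathcomp Require Import classical_sets reals.
(* Imported last so that set0, setT, ... denote the operations of finset. *)
From mathcomp Require Import all_boot all_order all_algebra.

Set Implicit Arguments.
Unset Strict Implicit.
Unset Printing Implicit Defensive.

Import Order.TTheory GRing.Theory Num.Theory.
Local Open Scope ring_scope.

Record sgraph (T : finType) := SGraph {
  adj :> rel T;
  adj_sym : symmetric adj;
  adj_irrefl : irreflexive adj
}.

Lemma compl_sym (T : finType) (G : sgraph T) :
  symmetric [rel x y | (x != y) && ~~ G x y].
Proof. by move=> x y /=; rewrite eq_sym adj_sym. Qed.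

Lemma compl_irrefl (T : finType) (G : sgraph T) :
  irreflexive [rel x y | (x != y) && ~~ G x y].
Proof. by move=> x /=; rewrite eqxx. Qed.

Definition compl (T : finType) (G : sgraph T) : sgraph T :=
  SGraph (compl_sym G) (compl_irrefl G).

Section Blocks.
Variables (T : finType) (G : sgraph T).
Implicit Types (W B : {set T}) (v : T).

Definition induced W : rel T := [rel x y | [&& x \in W, y \in W & G x y]].

(* No two vertices of G[W] are separated; the empty graph satisfies this, so
   that deleting the vertex of a one-vertex graph does not disconnect it. *)
Definition not_disconnected W : bool :=
  [forall x in W, forall y in W, connect (induced W) x y].

Definition connected_graph W : bool := (W != set0) && not_disconnected W.

Definition is_cut_vertex W v : bool :=
  (v \in W) && ~~ not_disconnected (W :\ v).

(* A block is represented by its vertex set.  A maximal connected subgraph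
   without cut vertex is an induced subgraph, because adding edges between its
   vertices neither disconnects it nor creates a cut vertex. *)
Definition is_block B : bool :=
  maxset (fun W => connected_graph W && [forall v, ~~ is_cut_vertex W v]) B.

Definition blocks : {set {set T}} := [set B | is_block B].

Definition cut_vertices : {set T} := [set v | is_cut_vertex [set: T] v].

Definition is_clique B : Prop := {in B &, forall x y, x != y -> G x y}.

Definition clique_tree : Prop :=
  connected_graph [set: T] /\ forall B, B \in blocks -> is_clique B.

Definition end_clique B : bool :=
  (B \in blocks) && (#|B :&: cut_vertices| == 1%N).

End Blocks.

(* The data chosen in G to build S(s-2,1): a clique K containing two cut
   vertices w and w', and a second clique K' containing w'. *)
Definition S_choice (T : finType) (G : sgraph T) (w w' : T) (K K' : {set T}) :
    Prop :=
  [/\ [/\ w \in cut_vertices G, w' \in cut_vertices G & w != w'],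
      [/\ K \in blocks G, w \in K & w' \in K] &
      [/\ K' \in blocks G, K' != K & w' \in K']].

(* H is the clique tree S(s-2,1) built from G with the choice (w, w', K, K').
   The rearrangement of the cliques is a bijection phi from the cliques of G
   to those of H preserving the number of vertices of each clique; phi K and
   phi K' play the roles of K and K' in H. *)
Definition is_S (T : finType) (G : sgraph T) (w w' : T) (K K' : {set T})
    (H : sgraph T) : Prop :=
  clique_tree H /\ cut_vertices H = [set w; w'] /\
  exists phi : {set T} -> {set T},
    [/\ [/\ {in blocks G &, injective phi},
            [set phi B | B in blocks G] = blocks H &
            {in blocks G, forall B, #|phi B| = #|B|}],
        w \in phi K /\ w' \in phi K,
        end_clique H (phi K') /\ w' \in phi K',
        {in blocks G, forall B, w' \in phi B -> B = K \/ B = K'} &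
        {in blocks G, forall B, B <> K -> B <> K' ->
           end_clique H (phi B) /\ w \in phi B}].

Definition adjmx (R : realType) (n : nat) (G : sgraph 'I_n) : 'M[R]_n :=
  \matrix_(i, j) (G i j)%:R.

(* The set of eigenvalues of a matrix is finite; for a real symmetric matrix
   of positive order it is nonempty, so this supremum is its maximum. *)
Definition lambda1 (R : realType) (n : nat) (A : 'M[R]_n) : R :=
  sup [set a : R | eigenvalue A a]%classic.

(* Main.v *)
Require Import Defs.
From mathcomp Require Import classical_sets reals.
From mathcomp Require Import all_boot all_order all_algebra.
From mathcomp Require Import fingroup perm spectral.
From mathcomp.real_closed Require Import complex.
Set Implicit Arguments.
Unset Strict Implicit.
Unset Printing Implicit Defensive.
Import Order.TTheory GRing.Theory Num.Theory.
Local Open Scope ring_scope.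

(* Let [x] be a nonnegative vector attaining the Rayleigh quotient of the
   complement of the clique tree, and let [w] minimise [x] over the cut
   vertices.  Root the block tree at the clique [K]: every other clique [B] hangs
   at a cut vertex [rt B], and every vertex outside [K] is a non-root vertex of
   exactly one clique.  Rehanging at [w] all cliques other than [K] and [K']
   replaces the edges from [rt B] to [B :\ rt B] by edges from [w], so it does not
   increase the quadratic form of the clique tree at [x], hence does not decrease
   that of its complement.  The result is isomorphic to [S(s-2,1)], because
   cliques of equal size can be matched vertex by vertex. *)

(** * Connectivity of induced subgraphs and nonseparable vertex sets *)

Lemma connect_closed_in (T : finType) (e : rel T) (C : {set T}) (x y : T) :
  (forall a b, e a b -> a \in C -> b \in C) ->
  connect e x y -> x \in C -> y \in C.
Proof.
move=> eC /connectP[p]; elim: p x => [|z p IHp] x /= => [_ -> //|].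
by move=> /andP[/eC exz /IHp{}IHp] /IHp{}IHp /exz.
Qed.

Section Separation.
Variables (T : finType) (G : sgraph T).
Implicit Types (A B C U W K : {set T}) (x y z u v : T).

Lemma connectedP W :
  reflect {in W &, forall x y, connect (induced G W) x y}
          (not_disconnected G W).
Proof.
apply: (iffP forall_inP) => [WP x y xW yW | WP x xW].
  exact: (forall_inP (WP x xW)).
by apply/forall_inP => y yW; apply: WP.
Qed.

Lemma inducedE W x y :
  induced G W x y = [&& x \in W, y \in W & G x y].
Proof. by []. Qed.

Lemma induced_sym W : symmetric (induced G W).
Proof. by move=> x y; rewrite !inducedE (adj_sym G) andbCA. Qed.

Lemma connect_inducedC W : connect_sym (induced G W).
Proof. exact/sym_connect_sym/induced_sym. Qed.

Lemma connect_induced_sub A B x y :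
  A \subset B -> connect (induced G A) x y -> connect (induced G B) x y.
Proof.
move=> /subsetP sAB; apply: connect_sub => a b /and3P[aA bA ab].
by apply: connect1; rewrite inducedE !sAB.
Qed.

Lemma connected_clique W : is_clique G W -> not_disconnected G W.
Proof.
move=> Wc; apply/connectedP => x y xW yW; have [->//|xy] := eqVneq x y.
by apply: connect1; rewrite inducedE xW yW Wc.
Qed.

Lemma connected_setU A B a b :
    not_disconnected G A -> not_disconnected G B -> a \in A -> b \in B ->
  (a == b) || G a b -> not_disconnected G (A :|: B).
Proof.
move=> /connectedP cA /connectedP cB aA bB ab.
have ab' : connect (induced G (A :|: B)) a b.
  case/predU1P: ab => [->//|ab]; apply: connect1.
  by rewrite inducedE !inE aA bB orbT.
have toa x : x \in A :|: B -> connect (induced G (A :|: B)) x a.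
  case/setUP => [xA|xB].
    by apply: connect_induced_sub (cA _ _ xA aA); apply: subsetUl.
  rewrite connect_inducedC; apply: connect_trans ab' _.
  by apply: connect_induced_sub (cB _ _ bB xB); apply: subsetUr.
apply/connectedP => x y /toa xa /toa ya; apply: connect_trans xa _.
by rewrite connect_inducedC.
Qed.

(** The property whose maximal sets are the blocks. *)
Definition nonseparable W : bool :=
  connected_graph G W && [forall v, ~~ is_cut_vertex G W v].

Lemma nonseparableP W :
  reflect [/\ W != set0, not_disconnected G W &
              forall v, not_disconnected G (W :\ v)] (nonseparable W).
Proof.
rewrite /nonseparable /connected_graph.
apply: (iffP andP) => [[/andP[W0 cW] /forallP nW] | [W0 cW nW]].
  split=> // v; have := nW v; rewrite /is_cut_vertex negb_and negbK.
  case: (boolP (v \in W)) => //= vW _.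
  by rewrite (setDidPl _) // disjoint_sym disjoints1.
rewrite W0 cW; split=> //; apply/forallP => v.
by rewrite negb_and negbK nW orbT.
Qed.

Lemma nonseparable_clique W : W != set0 -> is_clique G W -> nonseparable W.
Proof.
move=> W0 Wc; apply/nonseparableP; split=> // [|v];
  apply: connected_clique => //.
by move=> x y /setD1P[_ xW] /setD1P[_ yW]; apply: Wc.
Qed.

(** Whichever vertex is deleted, one of [x] and [y] survives and joins what is left of [A] and
    [B]. *)
Lemma nonseparable_setU A B x y :
    nonseparable A -> nonseparable B -> x != y ->
    x \in A :&: B -> y \in A :&: B ->
  nonseparable (A :|: B).
Proof.
move=> /nonseparableP[A0 cA nA] /nonseparableP[_ cB nB] xy.
move=> /setIP[xA xB] /setIP[yA yB]; apply/nonseparableP; split=> [||v].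
- by apply/set0Pn; exists x; rewrite inE xA.
- by apply: (connected_setU cA cB xA xB); rewrite eqxx.
rewrite setDUl; have [xv|xv] := eqVneq x v.
  by apply: (@connected_setU _ _ y y); rewrite ?eqxx ?inE -?xv ?(eq_sym y) ?xy.
by apply: (@connected_setU _ _ x x); rewrite ?eqxx ?inE ?xv.
Qed.

(** * Blocks, and how the rest of the graph attaches to them *)

Lemma block_nonseparable B : B \in blocks G -> nonseparable B.
Proof. by rewrite inE => /maxsetp. Qed.

Lemma block_max B W : B \in blocks G -> nonseparable W -> B \subset W -> W = B.
Proof. by rewrite inE => /maxsetP[_]; apply. Qed.

Lemma eq_block B1 B2 x y :
    B1 \in blocks G -> B2 \in blocks G -> x != y ->
    x \in B1 -> y \in B1 -> x \in B2 -> y \in B2 ->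
  B1 = B2.
Proof.
move=> B1b B2b xy x1 y1 x2 y2.
have nU : nonseparable (B1 :|: B2).
  apply: nonseparable_setU xy _ _; try exact: block_nonseparable.
    by rewrite inE x1.
  by rewrite inE y1.
by rewrite -(block_max B1b nU) ?subsetUl // (block_max B2b nU) ?subsetUr.
Qed.

Lemma adj_block x y :
  G x y -> exists B, [/\ B \in blocks G, x \in B & y \in B].
Proof.
move=> xy; have nxy : nonseparable [set x; y].
  apply: nonseparable_clique.
    by apply/set0Pn; exists x; rewrite !inE eqxx.
  by move=> a b /set2P[]-> /set2P[]->; rewrite ?eqxx // (adj_sym G).
have [B Bmax /subsetP sB] := maxset_exists nxy.
by exists B; rewrite inE; split=> //; apply: sB; rewrite !inE eqxx ?orbT.
Qed.

Lemma sorted_connected s : sorted G s -> not_disconnected G [set z in s].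
Proof.
elim: s => [_|x [|y s] IHs] /=.
- by apply/connectedP => x y; rewrite inE.
- move=> _; apply: connected_clique => a b.
  by rewrite !inE => /eqP-> /eqP->; rewrite eqxx.
move=> /andP[xy ys]; rewrite set_cons.
apply: (@connected_setU _ _ x y); rewrite ?IHs ?inE ?eqxx ?xy ?orbT //.
by apply: connected_clique => a b /set1P-> /set1P->; rewrite eqxx.
Qed.

(** The attachment condition is guarded because a piece of a path cut at a vertex may be empty. *)
Lemma connected_setU_sorted A s u :
    not_disconnected G A -> sorted G s -> u \in A ->
    (s != [::] -> exists2 d, d \in s & G d u) ->
  not_disconnected G (A :|: [set z in s]).
Proof.
move=> cA cs uA; case: s cs => [|c s] cs att.
  have -> : [set z in [::]] = set0 :> {set T}.
    by apply/setP=> z; rewrite !inE.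
  by rewrite setU0.
have [//|d ds du] := att.
apply: (@connected_setU _ _ u d); rewrite ?sorted_connected ?inE //.
by rewrite (adj_sym G) du orbT.
Qed.

(* Each component of [~: U] has at most one neighbour in [U]. *)
Definition single_attachment U :=
  forall a b u v, connect (induced G (~: U)) a b ->
    a \notin U -> b \notin U -> u \in U -> v \in U -> G a u -> G b v -> u = v.

(* A path leaving a block [B] at [u] and coming back at [v != u] would be an ear
   of [B], and adding it to [B] gives a larger nonseparable set. *)
Lemma block_single_attachment B : B \in blocks G -> single_attachment B.
Proof.
move=> Bb a b u v /connectP[p0 p0P bE] aB bB uB vB au bv; apply/eqP.
apply: contraNT (aB) => uv.
case/shortenP: p0P bE => p pP pU _ bE {p0}.
have [B0 cB nB] := nonseparableP _ (block_nonseparable Bb).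
have sG : sorted G (a :: p) by apply: sub_path pP => c d /and3P[].
pose W := B :|: [set z in a :: p].
have bp : b \in a :: p by rewrite bE mem_last.
suff nW : nonseparable W.
  by rewrite -(block_max Bb nW) ?subsetUl // !inE eqxx orbT.
have cW : not_disconnected G W.
  by apply: (connected_setU_sorted cB sG uB) => _; exists a; rewrite ?mem_head.
apply/nonseparableP; split=> // [|z].
  by apply/set0Pn; exists u; rewrite inE uB.
(* If the deleted [z] is off the ear, the whole ear still hangs at one of [u] and [v]. *)
have [zp|zp] := boolP (z \in a :: p); last first.
  have -> : W :\ z = (B :\ z) :|: [set z in a :: p].
    apply/setP => c; rewrite !in_setD1 !in_setU in_setD1 in_set.
    by case: eqVneq => // ->; rewrite (negbTE zp).
  have [uz|uz] := eqVneq u z.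
    apply: (@connected_setU_sorted _ _ v) => //.
      by rewrite !inE -uz eq_sym uv.
    by move=> _; exists b.
  apply: (@connected_setU_sorted _ _ u) => //; first by rewrite !inE uz.
  by move=> _; exists a; rewrite ?mem_head.
have zB : z \notin B.
  move: zp; rewrite inE => /predU1P[->|zp].
    by [].
  have := pP; case/splitPr: zp => p1 p2.
  by rewrite cat_path /= => /and3P[_ /and3P[_ ]]; rewrite inE.
(* Deleting a vertex of the ear leaves two pieces, one joined to [B] at [u] and the other at [v]. *)
have [s1 [s2 sE]] : exists s1 s2, a :: p = s1 ++ z :: s2.
  by case/splitPr: zp => s1 s2; exists s1, s2.
have := pU; rewrite sE cat_uniq /= negb_or.
move=> /and4P[_ /andP[z1 _] z2 _].
have -> : W :\ z = (B :|: [set c in s1]) :|: [set c in s2].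
  apply/setP => c; rewrite !inE -in_cons sE mem_cat in_cons.
  case: eqVneq => [->|_] /=; last by rewrite !orbA.
  by rewrite (negbTE zB) (negbTE z1) (negbTE z2).
have /cat_sorted2[s1G /= /path_sorted s2G] : sorted G (s1 ++ z :: s2).
  by rewrite -sE.
apply: (@connected_setU_sorted _ _ v); rewrite ?inE ?vB //.
  apply: (@connected_setU_sorted _ _ u) => //.
  by case: s1 sE {z1 s1G} => // _ s1 [<- _] _; exists a; rewrite ?mem_head.
have: last a p = last z s2 by rewrite -[LHS]/(last a (a :: p)) sE last_cat.
rewrite -bE; case: s2 {sE z2 s2G} => //= d s2 bE2 _.
by exists b => //; rewrite bE2 mem_last.
Qed.

(** The component of [y] outside [U] touches [U] only at [x], so deleting [x] separates it from
    [z]. *)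
Lemma attachment_cut_vertex U x y z :
    single_attachment U -> x \in U -> y \notin U -> G x y ->
    z \in U -> z != x ->
  x \in cut_vertices G.
Proof.
move=> attU xU yU xy zU zx; rewrite inE /is_cut_vertex inE /=.
apply/negP => /connectedP cx.
pose C := [set c | connect (induced G (~: U)) y c].
have CU c : c \in C -> c \notin U.
  rewrite inE => yc; have : c \in ~: U; last by rewrite inE.
  by apply: (connect_closed_in _ yc); rewrite ?inE // => a b /and3P[].
have yx : y != x by apply: contraNneq yU => ->.
have yz := cx y z; rewrite !inE yx zx in yz.
have /CU/negP[] // : z \in C.
apply: (connect_closed_in _ (yz isT isT)); last by rewrite inE connect0.
move=> a b; rewrite inducedE !inE => /and3P[_ /andP[bx _] ab] ya.
have aU : a \notin U by apply: CU; rewrite inE.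
have [bU|bU] := boolP (b \in U).
  have xb := attU y a x b ya yU aU xU bU; rewrite (adj_sym G) in xb.
  by rewrite xb ?eqxx in bx.
by apply: connect_trans ya _; apply: connect1; rewrite inducedE !inE aU bU.
Qed.

(** * Rooting the block tree *)

Lemma connected_crossing U x y :
    not_disconnected G [set: T] -> x \in U -> y \notin U ->
  exists a b, [/\ a \in U, b \notin U & G a b].
Proof.
move=> /connectedP cT xU yU; have xy := cT x y (in_setT _) (in_setT _).
have [/existsP[a /existsP[b /and3P[aU bU ab]]]|/existsPn noab] :=
  boolP [exists a, exists b, [&& a \in U, b \notin U & G a b]].
  by exists a, b.
case/negP: yU; apply: (connect_closed_in _ xy xU) => a b /and3P[_ _ ab] aU.
apply: contraT => bU; have /existsPn/(_ b) := noab a.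
by rewrite aU bU ab.
Qed.

(* The family [F] of blocks is a subtree of the block tree, rooted at the block
   [K]: a block [B != K] of [F] is attached to its parent at the vertex [rt B],
   and [par v] is the block of [F] closest to [K] among those containing [v]. *)
Record rooted_blocks (K : {set T}) (F : {set {set T}}) (rt : {set T} -> T)
    (par : T -> {set T}) : Prop := RootedBlocks {
  rooted_root : K \in F;
  rooted_par : forall v, v \in cover F -> par v \in F /\ v \in par v;
  rooted_rt : forall B, B \in F -> B != K ->
    [/\ rt B \in B, rt B \in cut_vertices G & par (rt B) != B];
  rooted_mem : forall B v, B \in F -> v \in B ->
    par v = B \/ B != K /\ v = rt B
}.

Lemma mem_cover (F : {set {set T}}) B v : B \in F -> v \in B -> v \in cover F.
Proof. by move=> BF vB; apply/bigcupP; exists B. Qed.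

(** The family grows from [K] by one block at a time: an edge leaving the covered set lies in a
    block that meets this set only at the inner end of the edge. Single attachment is the invariant
    that guarantees this. *)
Lemma rooted_blocks_exist K k1 k2 :
    clique_tree G -> K \in blocks G -> k1 \in K -> k2 \in K -> k1 != k2 ->
  exists rt par, rooted_blocks K (blocks G) rt par.
Proof.
move=> [/andP[_ cT] cl] Kb k1K k2K k12.
pose inv (F : {set {set T}}) (rt : {set T} -> T) (par : T -> {set T}) :=
  [/\ F \subset blocks G, single_attachment (cover F),
  forall a b, a \in cover F -> b \in cover F -> G a b ->
    exists B, [/\ B \in F, a \in B & b \in B] &
  rooted_blocks K F rt par].
suff [F [rt [par [[sF _ edF rF] FT]]]] :
    exists F rt par, inv F rt par /\ cover F = setT.
  exists rt, par; suff <- : F = blocks G by [].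
  apply/eqP; rewrite eqEsubset sF; apply/subsetP => B Bb.
  have /nonseparableP[/set0Pn[x xB] _ _] := block_nonseparable Bb.
  (* No block is a singleton: by connectedness and [k1 != k2] an edge leaves [x], and it lies in a
     block. *)
  have [y yB yx] : exists2 y, y \in B & y != x.
    have [Bx|/subsetPn[y yB yx]] := boolP (B \subset [set x]); last first.
      by exists y; rewrite ?inE // in yx *.
    have [k kx] : exists k, k \notin [set x].
      have [k1x|] := eqVneq k1 x; last by exists k1; rewrite inE.
      by exists k2; rewrite inE -k1x eq_sym.
    have [_ [b [/set1P-> bx xb]]] := connected_crossing cT (set11 x) kx.
    have [B' [B'b xB' bB']] := adj_block xb.
    exists b; last by rewrite inE in bx.
    rewrite -(block_max Bb (block_nonseparable B'b)) //.
    by apply: subset_trans Bx _; rewrite sub1set.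
  rewrite eq_sym in yx; have xy : G x y by apply: (cl B Bb).
  have [|||B' [B'F xB' yB']] := edF x y; rewrite ?FT //.
  by rewrite (eq_block Bb (subsetP sF _ B'F) yx xB yB xB' yB').
(* The constant root [k1] is a dummy value, as [K] has no parent. *)
have init : inv [set K] (fun=> k1) (fun=> K).
  have cK : cover [set K] = K by rewrite /cover big_set1.
  split; rewrite ?sub1set ?cK //.
  - exact: block_single_attachment.
  - by move=> a b aK bK _; exists K; rewrite inE.
  split; rewrite ?cK ?inE //; first by move=> B /set1P->; rewrite eqxx.
  by move=> B v /set1P-> _; left.
suff step F rt par :
    inv F rt par -> exists F rt par, inv F rt par /\ cover F = setT.
  exact: step init.
have [m leFm] := ubnP #|~: cover F|.
elim: m => // m IHm in F rt par leFm * => -[sF attF edF rF].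
have [FT|] := eqVneq (cover F) setT; first by exists F, rt, par.
rewrite -subTset => /subsetPn[y0 _ y0F].
set U := cover F in attF edF leFm y0F *.
have KU : K \subset U by apply: (@bigcup_sup _ _ K) => //; case: rF.
have [x [y [xU yU xy]]] := connected_crossing cT (subsetP KU _ k1K) y0F.
have [B [Bb xB yB]] := adj_block xy.
have clB := cl B Bb.
(* The vertex [y] outside [U] is adjacent to both [v] and [x]. *)
have BUx v : v \in B -> v \in U -> v = x.
  move=> vB vU; apply: (attF y y v x); rewrite // 1?(adj_sym G) //.
  by apply: clB => //; apply: contraNneq yU => <-.
have BF : B \notin F by apply: contraNN yU => BF; apply: mem_cover BF yB.
have BK : B != K by apply: contraNneq BF => ->; case: rF.
have cU : cover (B |: F) = B :|: U by rewrite /cover bigcup_setU big_set1.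
have neB B' : B' \in F -> (B' == B) = false.
  by move=> B'F; apply: contraNF BF => /eqP <-.
(* The new block hangs at [x] and becomes the parent of its vertices outside [U]; older blocks and
   vertices keep their data. *)
apply: (IHm (B |: F) (fun B' => if B' == B then x else rt B')
                     (fun v => if v \in U then par v else B)).
  rewrite cU -ltnS; apply: leq_trans leFm; rewrite ltnS proper_card //.
  rewrite setCU properE subsetIr /=; apply/subsetPn; exists y; rewrite !inE //.
  by rewrite yB.
have [rK rpar rrt rmem] := rF.
have Ux B' v : B' \in F -> v \in B' -> v \in U by apply: mem_cover.
have attB := block_single_attachment Bb.
(* With [v] outside [U] and [u] outside [B], the path prolonged to [v] still avoids [U] and attaches
   at both [u] and [x], so [u = x] would lie in [B]. *)
have mixed a b u v : connect (induced G (~: (B :|: U))) a b ->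
    a \notin B :|: U -> b \notin B :|: U -> u \in U -> v \in B ->
    G a u -> G b v -> u = v.
  move=> ab; rewrite !inE !negb_or => /andP[aB aU] /andP[bB bU] uU vB au bv.
  have abB : connect (induced G (~: B)) a b.
    by apply: connect_induced_sub ab; rewrite setCS subsetUl.
  have abU : connect (induced G (~: U)) a b.
    by apply: connect_induced_sub ab; rewrite setCS subsetUr.
  have [vU|vU] := boolP (v \in U); first exact: attF abU _ _ _ _ _ _.
  have [uB|uB] := boolP (u \in B); first exact: attB abB _ _ _ _ _ _.
  suff ux : u = x by rewrite ux xB in uB.
  apply: (attF a v) => //.
    by apply: connect_trans abU _; apply: connect1; rewrite inducedE !inE bU vU.
  by apply: clB => //; apply: contraNneq vU => ->.
split.
- by rewrite subUset sub1set Bb.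
- rewrite cU => a b u v ab aW bW /setUP[uB|uU] /setUP[vB|vU] au bv.
  + move: aW bW; rewrite !inE !negb_or => /andP[aB _] /andP[bB _].
    apply: attB au bv => //.
    by apply: connect_induced_sub ab; rewrite setCS subsetUl.
  + by apply/esym; apply: (mixed b a) => //; rewrite connect_inducedC.
  + exact: (mixed a b).
  + move: aW bW; rewrite !inE !negb_or => /andP[_ aU] /andP[_ bU].
    apply: attF au bv => //.
    by apply: connect_induced_sub ab; rewrite setCS subsetUr.
- have edBU a b : a \in B -> a \notin U -> b \in U -> G a b -> b \in B.
    move=> aB aU bU ab; suff -> : b = x by [].
    apply: (attF a a) => //; apply: clB => //.
    by apply: contraNneq aU => ->.
  have inB a b : a \in B -> b \in B ->
      exists B', [/\ B' \in B |: F, a \in B' & b \in B'].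
    by move=> aB bB; exists B; rewrite !inE eqxx.
  move=> a b; rewrite cU.
  have [aU _|aU] := boolP (a \in U); have [bU|bU] := boolP (b \in U).
  + move=> _ ab; have [B' [B'F aB' bB']] := edF a b aU bU ab.
    by exists B'; rewrite !inE B'F orbT.
  + rewrite !inE (negbTE bU) orbF => bB; rewrite (adj_sym G) => ba.
    by apply: inB => //; apply: edBU ba.
  + rewrite !inE (negbTE aU) orbF => aB _ ab.
    by apply: inB => //; apply: edBU ab.
  + by rewrite !inE (negbTE aU) (negbTE bU) !orbF => aB bB _; apply: inB.
split.
- by rewrite !inE rK orbT.
- rewrite cU => v; have [vU _|vU] := boolP (v \in U).
    by have [pF vp] := rpar v vU; rewrite !inE pF orbT.
  by rewrite !inE (negbTE vU) eqxx orbF => ->.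
- move=> B'; rewrite in_setU1; have [-> _ _|_ /= B'F B'K] := eqVneq B' B.
    rewrite xU; split=> //; last first.
      by apply: contraNneq BF => <-; case: (rpar x xU).
    have [k kU kx] : exists2 k, k \in U & k != x.
      have [k1x|] := eqVneq k1 x; last by exists k1; rewrite ?(subsetP KU).
      by exists k2; rewrite ?(subsetP KU) // -k1x eq_sym.
    exact: attachment_cut_vertex attF xU yU xy kU kx.
  by have [rB rc rp] := rrt B' B'F B'K; rewrite (Ux _ _ B'F rB).
move=> B' v; rewrite !inE; have [-> _ vB|_ /= B'F vB'] := eqVneq B' B.
  by have [vU|vU] := boolP (v \in U); [right; rewrite BK (BUx v vB vU)|left].
by rewrite (Ux _ _ B'F vB'); apply: rmem.
Qed.

End Separation.

(** * Edges of a rooted clique tree, and its cut vertices *)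

Section CliqueTree.
Variables (T : finType) (G : sgraph T).
Hypothesis Gtree : clique_tree G.
Implicit Types (B K : {set T}) (a b u v w : T).

Lemma mem_block v : exists2 B, B \in blocks G & v \in B.
Proof.
have nv : nonseparable G [set v].
  apply: nonseparable_clique; first by apply/set0Pn; exists v; rewrite inE.
  by move=> a b /set1P-> /set1P->; rewrite eqxx.
have [B Bmax] := maxset_exists nv; rewrite sub1set => vB.
by exists B => //; rewrite inE.
Qed.

Lemma block_adj B a b : B \in blocks G -> a \in B -> b \in B -> a != b -> G a b.
Proof. by move=> Bb; apply: (Gtree.2 B Bb). Qed.

Section Rooted.
Variables (K : {set T}) (rt : {set T} -> T) (par : T -> {set T}).
Hypothesis rK : rooted_blocks G K (blocks G) rt par.

Lemma par_block v : par v \in blocks G.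
Proof.
have [B Bb vB] := mem_block v.
by case: (rooted_par rK (mem_cover Bb vB)).
Qed.

Lemma mem_par v : v \in par v.
Proof.
have [B Bb vB] := mem_block v.
by case: (rooted_par rK (mem_cover Bb vB)).
Qed.

Lemma par_root v : v \in K -> par v = K.
Proof.
by case/(rooted_mem rK (rooted_root rK)) => // -[]; rewrite eqxx.
Qed.

Lemma rt_meet_root B v :
  B \in blocks G -> B != K -> v \in B -> v \in K -> v = rt B.
Proof.
move=> Bb BK vB vK; case: (rooted_mem rK Bb vB) => [vE|[]//].
by rewrite -vE (par_root vK) eqxx in BK.
Qed.

Lemma par_fiber B : B \in blocks G ->
  [set v | par v == B] = if B == K then K else B :\ rt B.
Proof.
move=> Bb; apply/setP => v; rewrite inE; have [->|BK] := eqVneq B K.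
  by apply/eqP/idP => [<-|/par_root//]; apply: mem_par.
have [_ _ prB] := rooted_rt rK Bb BK.
rewrite !inE; apply/eqP/andP => [vE|[vr vB]].
  by split; [apply: contraNneq prB => <-; apply/eqP | rewrite -vE mem_par].
by case: (rooted_mem rK Bb vB) => [//|[_ vE]]; rewrite vE eqxx in vr.
Qed.

(** Fibre sizes depend only on block sizes, so a size-preserving bijection of blocks also matches
    the fibres of two rooted clique trees. *)
Lemma card_par_fiber B : B \in blocks G ->
  #|[set v | par v == B]| = if B == K then #|B| else #|B|.-1.
Proof.
move=> Bb; rewrite par_fiber //; have [->//|BK] := eqVneq B K.
by have [rB _ _] := rooted_rt rK Bb BK; rewrite (cardsD1 (rt B) B) rB.
Qed.

(** The block containing an edge is the parent of both ends, or of one end while the other is its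
    root. These cases exclude each other, so their truth values add up, which later splits the
    quadratic form. *)
Lemma adj_par a b :
  G a b = ((a != b) && (par a == par b) +
           ((par a != K) && (b == rt (par a)) +
            (par b != K) && (a == rt (par b))))%N :> nat.
Proof.
have rtne u v : par u != K -> v == rt (par u) ->
    [/\ u != v, v \in par u & par u != par v].
  move=> uK /eqP->; have [rB _ rP] := rooted_rt rK (par_block u) uK.
  rewrite eq_sym in rP; split=> //.
  by apply: contraNneq rP => {1}->.
have [ab|ab] := boolP (G a b); last first.
  have [ne_ab|] := eqVneq a b.
    rewrite ne_ab eqxx /=; case: (boolP (_ && _)) => // /andP[bK bE].
    by have [] := rtne _ _ bK bE; rewrite eqxx.
  move=> ne_ab; apply/esym/eqP; rewrite !addn_eq0 !eqb0; apply/and3P; split.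
  - apply: contraNN ab => /eqP abE.
    by apply: (block_adj (par_block a)); rewrite ?mem_par // abE mem_par.
  - apply: contraNN ab => /andP[aK bE]; have [_ bP _] := rtne _ _ aK bE.
    by apply: (block_adj (par_block a)); rewrite ?mem_par.
  - apply: contraNN ab => /andP[bK aE]; have [_ aP _] := rtne _ _ bK aE.
    by apply: (block_adj (par_block b)); rewrite ?mem_par.
have ne_ab : a != b by apply: contraTneq ab => ->; rewrite adj_irrefl.
have [B [Bb aB bB]] := adj_block ab; rewrite ne_ab /=.
(* Otherwise [a] and [b] would both lie in two distinct blocks. *)
have excl : ((par a != K) && (b == rt (par a))) &&
            ((par b != K) && (a == rt (par b))) = false.
  apply/negP => /andP[/andP[aK bE] /andP[bK aE]].
  have [_ bP] := rtne _ _ aK bE; have [_ aP _] := rtne _ _ bK aE.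
  by rewrite (eq_block (par_block a) (par_block b) ne_ab) ?mem_par ?eqxx.
have [aE|[BK aE]] := rooted_mem rK Bb aB;
  have [bE|[BK' bE]] := rooted_mem rK Bb bB.
- rewrite aE bE eqxx; have [->|BK] /= := eqVneq B K; first by [].
  have [_ _ rP] := rooted_rt rK Bb BK.
  have [bB'|_] := eqVneq b (rt B); first by rewrite -bB' bE eqxx in rP.
  by have [aB'|_] := eqVneq a (rt B); first by rewrite -aB' aE eqxx in rP.
- move: excl; have bt : b == rt (par a) by rewrite aE bE.
  have aK : par a != K by rewrite aE.
  have [_ _ /negbTE->] := rtne _ _ aK bt.
  by rewrite aK bt /= => ->.
- move: excl; have bt : a == rt (par b) by rewrite bE aE.
  have bK : par b != K by rewrite bE.
  have [_ _] := rtne _ _ bK bt; rewrite eq_sym => /negbTE->.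
  by rewrite bK bt /= andbT => ->.
- by rewrite aE bE eqxx in ne_ab.
Qed.

End Rooted.

(** With the block tree rooted at [B1], the vertex [u] is the root of [B2], and roots are cut
    vertices. *)
Lemma cut_vertex_two_blocks B1 B2 u v :
    B1 \in blocks G -> B2 \in blocks G -> B2 != B1 -> u \in B1 -> u \in B2 ->
    v \in B1 -> v != u ->
  u \in cut_vertices G.
Proof.
move=> B1b B2b B21 u1 u2 v1 vu.
have [rt [par rB1]] := rooted_blocks_exist Gtree B1b v1 u1 vu.
by rewrite (rt_meet_root rB1 B2b B21 u2 u1); case: (rooted_rt rB1 B2b B21).
Qed.

(* If [K] is the only block containing [u], then sending [u] to another vertex
   of [K] retracts the graph onto the complement of [u]. *)
Lemma cut_vertex_other_block K u v :
    K \in blocks G -> u \in K -> v \in K -> v != u -> u \in cut_vertices G ->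
  exists K', [/\ K' \in blocks G, K' != K & u \in K'].
Proof.
move=> Kb uK vK vu; rewrite inE /is_cut_vertex inE /= => ucut.
have [/existsP[K' /and3P[]]|/existsPn noK'] :=
  boolP [exists K', [&& K' \in blocks G, K' != K & u \in K']].
  by exists K'.
case/negP: ucut; apply/connectedP => x y; rewrite !inE !andbT => xu yu.
pose r z := if z == u then v else z.
have nbr z : G u z -> z \in K.
  move=> uz; have [B [Bb uB zB]] := adj_block uz.
  by have := noK' B; rewrite Bb uB andbT /= negbK => /eqP <-.
have rE a b :
    induced G setT a b -> connect (induced G ([set: T] :\ u)) (r a) (r b).
  rewrite inducedE !inE /= /r => ab.
  have [au|au] := eqVneq a u; have [bu|bu] := eqVneq b u; first by [].
  - have [->//|vb] := eqVneq v b; apply: connect1.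
    rewrite inducedE !inE vu bu /=.
    by apply: (block_adj Kb) => //; apply: nbr; rewrite -au.
  - have [->//|av] := eqVneq a v; apply: connect1.
    rewrite inducedE !inE vu au /=.
    by apply: (block_adj Kb) => //; apply: nbr; rewrite -bu (adj_sym G).
  - by apply: connect1; rewrite inducedE !inE au bu.
have /connectedP cT : not_disconnected G setT by case: Gtree => /andP[].
have -> : x = r x by rewrite /r (negbTE xu).
have -> : y = r y by rewrite /r (negbTE yu).
have /connectP[p pP ->] := cT x y (in_setT _) (in_setT _).
elim: p x pP {xu} => //= z p IHp x /andP[/rE xz /IHp].
exact: connect_trans.
Qed.

(** If [v] is not a neighbour of [w], some edge leaves the closed neighbourhood of [w]; its inner
    end lies in two blocks. *)
Lemma adjacent_cut_vertex w v :
    w \in cut_vertices G -> v \in cut_vertices G -> v != w ->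
  exists2 u, u \in cut_vertices G & G w u.
Proof.
move=> wcut vcut vw; have [wv|wv] := boolP (G w v); first by exists v.
pose N := w |: [set z | G w z].
have vN : v \notin N by rewrite !inE negb_or vw.
have cT : not_disconnected G setT by case: Gtree => /andP[].
have [u [z [uN zN uz]]] := connected_crossing cT (setU11 w _) vN.
move: uN zN; rewrite !inE negb_or => /predU1P[uw|wu] /andP[zw wz].
  by rewrite -uw uz in wz.
exists u => //.
have [B1 [B1b w1 u1]] := adj_block wu; have [B2 [B2b u2 z2]] := adj_block uz.
apply: (cut_vertex_two_blocks B1b B2b _ u1 u2 w1).
  apply: contraNneq wz => B21; rewrite B21 in z2.
  by apply: (block_adj B1b) => //; rewrite eq_sym.
by apply: contraTneq wu => ->; rewrite adj_irrefl.
Qed.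

Lemma S_choice_exists w v :
    w \in cut_vertices G -> v \in cut_vertices G -> v != w ->
  exists w' K K', S_choice G w w' K K'.
Proof.
move=> wcut vcut vw; have [u ucut wu] := adjacent_cut_vertex wcut vcut vw.
have [K [Kb wK uK]] := adj_block wu.
have nwu : w != u by apply: contraTneq wu => ->; rewrite adj_irrefl.
have [K' [K'b K'K uK']] := cut_vertex_other_block Kb uK wK nwu ucut.
by exists u, K, K'.
Qed.

End CliqueTree.

(** * The Rayleigh quotient of a real symmetric matrix *)

Local Open Scope sesquilinear_scope.

(** The spectral theorem over [R[i]] gives a unitary diagonalisation with real eigenvalues [e i]; in
    its coordinates the form is a sum of the squares [|z 0 i| ^ 2] weighted by [e i], bounded
    through the largest weight. *)
Lemma symmetric_rayleigh_max (R : realType) (n : nat) (A : 'M[R]_n) :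
    (0 < n)%N -> A^T = A ->
  exists2 a, eigenvalue A a &
    forall y : 'rV[R]_n, (y *m A *m y^T) 0 0 <= a * (y *m y^T) 0 0.
Proof.
move=> n_gt0 A_sym.
pose toC := @real_complex_def R (Phant R) : {rmorphism R -> R[i]}.
pose AC := map_mx toC A; pose P := spectralmx AC; pose d := spectral_diag AC.
have AC_herm : AC \is hermsymmx.
  apply: realsym_hermsym.
    apply/is_hermitianmxP; rewrite expr0 scale1r map_mx_id //.
    by rewrite /AC map_trmx A_sym.
  by apply/mxOverP => i j; rewrite mxE complex_real.
have PU : P \is unitarymx by apply: spectral_unitarymx.
have ACE : AC = P^t* *m diag_mx d *m P.
  by rewrite -invmx_unitary //; apply/orthomx_spectralP/hermitian_normalmx.
have dreal i : d 0 i = (complex.Re (d 0 i))%:C%C.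
  by rewrite RRe_real //; apply/mxOverP/hermitian_spectral_diag_real.
pose e i := complex.Re (d 0 i).
have [i0 emax] : exists i0, forall i, e i <= e i0.
  case: (@arg_maxP _ _ _ (Ordinal n_gt0) xpredT e isT) => i _ imax.
  by exists i => j; apply: imax.
exists (e i0).
  (* Being an eigenvalue descends from [AC] to [A], and row [i0] of [P] is a complex eigenvector. *)
  rewrite -(eigenvalue_map toC) -/AC; apply/eigenvalueP; exists (row i0 P).
    rewrite -row_mul ACE !mulmxA (unitarymxP PU) mul1mx row_mul row_diag_mx.
    by rewrite -scalemxAl -rowE dreal.
  apply/negP => /eqP Pi0; have := unitarymxP PU => /matrixP/(_ i0 i0).
  rewrite !mxE eqxx big1 => [|j _]; first by move/eqP; rewrite eq_sym oner_eq0.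
  by have /rowP/(_ j) := Pi0; rewrite !mxE => ->; rewrite mul0r.
move=> y; pose yC := map_mx toC y; pose z := yC *m P^t*.
have yCT : yC^t* = yC^T.
  by apply/matrixP => i j; rewrite !mxE; apply/CrealP; rewrite complex_real.
have zT : z^t* = P *m yC^T by rewrite /z trmx_mul map_mxM /= yCT trmxCK.
have toC_form (B : 'M[R]_n) : toC ((y *m B *m y^T) 0 0) =
    (yC *m map_mx toC B *m yC^T) 0 0.
  by rewrite map_trmx -!map_mxM [RHS]mxE.
have formA : toC ((y *m A *m y^T) 0 0) = \sum_i d 0 i * `|z 0 i| ^+ 2.
  rewrite toC_form -/AC ACE !mulmxA -mulmxA -zT -/z mxE.
  by apply: eq_bigr => i _; rewrite mul_mx_diag !mxE normCK mulrAC mulrC mulrA.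
have form1 : toC ((y *m y^T) 0 0) = \sum_i `|z 0 i| ^+ 2.
  rewrite -[y in y *m _]mulmx1 toC_form map_mx1 -(mulmx1C (unitarymxP PU)).
  rewrite !mulmxA -mulmxA -zT -/z mxE.
  by apply: eq_bigr => i _; rewrite !mxE normCK.
rewrite -lecR.
change (toC ((y *m A *m y^T) 0 0) <= toC (e i0 * (y *m y^T) 0 0)).
rewrite rmorphM formA form1 mulr_sumr; apply: ler_sum => i _.
by rewrite ler_wpM2r ?exprn_ge0 // dreal lecR; apply: emax.
Qed.

(** The Rayleigh bound evaluated at eigenvectors shows that its constant, itself an eigenvalue,
    dominates all eigenvalues; so the supremum is attained. *)
Lemma lambda1_max (R : realType) (n : nat) (A : 'M[R]_n) :
    (0 < n)%N -> A^T = A ->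
  eigenvalue A (lambda1 A) /\
  forall y : 'rV[R]_n, (y *m A *m y^T) 0 0 <= lambda1 A * (y *m y^T) 0 0.
Proof.
move=> n_gt0 A_sym; have [a Aa rA] := symmetric_rayleigh_max n_gt0 A_sym.
suff -> : lambda1 A = a by [].
have ubA : ubound [set a : R | eigenvalue A a]%classic a.
  move=> b /eigenvalueP[v vA v0]; have := rA v; rewrite vA -scalemxAl mxE.
  rewrite ler_pM2r // lt_neqAle eq_sym; apply/andP; split; last first.
    by rewrite mxE sumr_ge0 // => i _; rewrite mxE -expr2 sqr_ge0.
  apply: contraNneq v0 => /eqP; rewrite mxE psumr_eq0 => [/allP v0|i _];
    last first.
    by rewrite mxE -expr2 sqr_ge0.
  apply/eqP/rowP => i; have := v0 i; rewrite mem_index_enum => /(_ isT).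
  by rewrite !mxE /= -expr2 sqrf_eq0 => /eqP.
apply/eqP; rewrite eq_le; apply/andP; split.
  by apply: ge_sup => //; exists a.
by apply: ub_le_sup => //; exists a.
Qed.

Local Close Scope sesquilinear_scope.

(** * Matching vertices by permutations *)

(** Equal fibre sizes mean that the value lists of [f] and [g] are rearrangements of each other. *)
Lemma fiber_perm (n : nat) (I : eqType) (f g : 'I_n -> I) :
    (forall i, #|[set u | f u == i]| = #|[set u | g u == i]|) ->
  exists s : {perm 'I_n}, forall v, g (s v) = f v.
Proof.
move=> fg.
have cE (h : 'I_n -> I) i :
    count_mem i [tuple h v | v < n] = #|[set u | h u == i]|.
  rewrite /= count_map enumT -size_filter cardE [in RHS]/enum_mem.
  by congr size; apply: eq_filter => u; rewrite !inE.
have /tuple_permP[s sE] : perm_eq [tuple f v | v < n] [tuple g v | v < n].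
  by apply/allP => i _ /=; rewrite !cE fg.
exists s => v; have /val_inj/(congr1 (fun t => tnth t v)) := sE.
by rewrite !tnth_mktuple => ->.
Qed.

(** Composing with the transposition of [s a] and [b], which lie in one fibre of [g], prescribes one
    value; this serves to make a matching fix [w] and [w']. *)
Lemma perm_adjust (n : nat) (I : Type) (f g : 'I_n -> I) (s : {perm 'I_n}) a b :
    (forall v, g (s v) = f v) -> f a = g b ->
  exists2 s' : {perm 'I_n}, (forall v, g (s' v) = f v) &
    s' a = b /\ forall c, s c != s a -> s c != b -> s' c = s c.
Proof.
move=> gs fab; exists (s * tperm (s a) b)%g => [v|].
  rewrite permM; case: tpermP => [saE|sbE|_ _].
  - by rewrite -fab -gs -saE gs.
  - by rewrite gs fab -sbE gs.
  - exact: gs.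
rewrite permM tpermL; split=> // c ca cb.
by rewrite permM tpermD // eq_sym.
Qed.

(** * Quadratic forms of graphs and the effect of rehanging cliques *)

Section EdgeForm.
Variable R : realType.

(** For a graph this is the quadratic form of the adjacency matrix, so every edge counts twice. *)
Definition edge_form (n : nat) (e : rel 'I_n) (x : 'I_n -> R) : R :=
  \sum_i \sum_j (e i j)%:R * (x i * x j).

Lemma edge_form_perm (n : nat) (e : rel 'I_n) (s : {perm 'I_n})
    (x : 'I_n -> R) :
  edge_form e (x \o (s^-1)%g) = edge_form (relpre s e) x.
Proof.
rewrite /edge_form (reindex_inj (@perm_inj _ s)); apply: eq_bigr => i _.
rewrite (reindex_inj (@perm_inj _ s)); apply: eq_bigr => j _ /=.
by rewrite !permK.
Qed.

Lemma edge_form_compl (n : nat) (G : sgraph 'I_n) (x : 'I_n -> R) :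
  edge_form (compl G) x =
    \sum_i \sum_j (i != j)%:R * (x i * x j) - edge_form G x.
Proof.
rewrite /edge_form -sumrB; apply: eq_bigr => i _.
rewrite -sumrB; apply: eq_bigr => j _; rewrite -mulrBl; congr (_ * _).
rewrite /=; have [<-|_] := eqVneq i j; first by rewrite adj_irrefl subr0.
by case: (G i j); rewrite ?subrr ?subr0.
Qed.

(** Only the second sum depends on where the blocks hang; its factor 2 comes from exchanging the two
    ends of an edge. *)
Lemma edge_form_rooted (n : nat) (e : rel 'I_n) (I : eqType)
    (par : 'I_n -> I) (P : pred 'I_n) (c : 'I_n -> 'I_n) (x : 'I_n -> R) :
    (forall a b, e a b = ((a != b) && (par a == par b) +
      (P a && (b == c a) + P b && (a == c b)))%N :> nat) ->
  edge_form e x = edge_form [rel a b | (a != b) && (par a == par b)] x +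
    (\sum_(a | P a) x a * x (c a)) *+ 2.
Proof.
move=> eE; pose h a b := (P a && (b == c a))%:R * (x a * x b).
have hE : \sum_a \sum_b h a b = \sum_(a | P a) x a * x (c a).
  rewrite [RHS]big_mkcond; apply: eq_bigr => a _; rewrite /h.
  case: (P a) => /=; last by apply: big1 => b _; rewrite mul0r.
  rewrite (bigD1 (c a)) //= eqxx mul1r big1 ?addr0 // => b /negbTE->.
  by rewrite mul0r.
rewrite mulr2n -{1}hE -hE [X in _ + (_ + X)]exchange_big /= -!big_split.
apply: eq_bigr => a _; rewrite /=.
rewrite -!big_split; apply: eq_bigr => b _ /=.
by rewrite /h eE !natrD !mulrDl [x b * x a]mulrC.
Qed.

(** After matching vertices with corresponding parents, the two forms differ only in their root
    terms, where minimality of [x w] and nonnegativity of [x] give the comparison. *)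
Lemma edge_form_S_le (n : nat) (G S : sgraph 'I_n) w w' K K' (x : 'I_n -> R) :
    clique_tree G -> S_choice G w w' K K' -> is_S G w w' K K' S ->
    (forall v, 0 <= x v) -> (forall v, v \in cut_vertices G -> x w <= x v) ->
  exists s : {perm 'I_n}, edge_form (relpre s S) x <= edge_form G x.
Proof.
move=> Gtree [[wcut w'cut ww'] [Kb wK w'K] [K'b K'K w'K']].
move=> [Stree [Scut [phi [[phi_inj phi_im phi_card] [wpK w'pK] [_ w'pK'] _]]]].
move=> phi_end x0 xw.
have phi_eq B1 B2 : B1 \in blocks G -> B2 \in blocks G ->
    (phi B1 == phi B2) = (B1 == B2).
  by move=> B1b B2b; apply: (inj_in_eq phi_inj).
have phib B : B \in blocks G -> phi B \in blocks S.
  by move=> Bb; rewrite -phi_im imset_f.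
have [rt [par rG]] := rooted_blocks_exist Gtree Kb wK w'K ww'.
have [rtS [parS rS]] := rooted_blocks_exist Stree (phib K Kb) wpK w'pK ww'.
have [s0 s0E] : exists s : {perm 'I_n}, forall v, parS (s v) = phi (par v).
  apply: fiber_perm => C; have [|Cb] := boolP (C \in blocks S); last first.
    rewrite !eq_card0 // => v; rewrite inE; apply: contraNF Cb => /eqP <-.
      exact: par_block rS v.
    by rewrite phib // (par_block rG).
  rewrite -phi_im => /imsetP[B Bb ->]; rewrite (card_par_fiber rS) ?phib //.
  rewrite phi_eq // phi_card // -(card_par_fiber rG Bb).
  by apply: eq_card => v; rewrite !inE phi_eq // (par_block rG).
(* Both [w] and [w'] have parent [K] in [G] and [phi K] in [S], so two successive adjustments make
   the matching fix them. *)
have [s1 s1E [s1w _]] := perm_adjust s0E (etrans (congr1 phi (par_root rG wK))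
  (esym (par_root rS wpK))).
have [s sE [sw' sfix]] := perm_adjust s1E (etrans (congr1 phi (par_root rG w'K))
  (esym (par_root rS w'pK))).
have sw : s w = w.
  by rewrite sfix s1w // -s1w (inj_eq perm_inj).
(* The vertex at which [B] hangs after the rearrangement, for [B] other than [K]. *)
pose r B := if B == K' then w' else w.
have rE B : B \in blocks G -> B != K -> rtS (phi B) = s (r B).
  move=> Bb BK; have pBK : phi B != phi K by rewrite phi_eq.
  rewrite /r; have [BE|BK'] := eqVneq B K'.
    rewrite sw'; apply/esym; apply: (rt_meet_root rS (phib B Bb) pBK _ w'pK).
    by rewrite BE.
  have [_ wpB] := phi_end B Bb (elimN eqP BK) (elimN eqP BK').
  by rewrite sw; apply/esym; apply: (rt_meet_root rS (phib B Bb) pBK wpB wpK).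
exists s.
have formG := edge_form_rooted x (adj_par Gtree rG).
have formS : edge_form (relpre s S) x =
    edge_form [rel a b | (a != b) && (par a == par b)] x +
    (\sum_(a | par a != K) x a * x (r (par a))) *+ 2.
  apply: edge_form_rooted => a b /=; rewrite (adj_par Stree rS) !sE.
  have rtE u v : (phi (par u) != phi K) && (s v == rtS (phi (par u))) =
      (par u != K) && (v == r (par u)).
    rewrite phi_eq ?(par_block rG) //; have [//|uK /=] := eqVneq (par u) K.
    by rewrite rE ?(par_block rG) // (inj_eq perm_inj).
  by rewrite !rtE (inj_eq perm_inj) phi_eq ?(par_block rG).
rewrite formS formG lerD2l lerMn2r /=; apply: ler_sum => a aK.
apply: ler_wpM2l => //; have ab := par_block rG a; rewrite /r.
(* The clique [K'] already hangs at [w'] in [G]; every other root is a cut vertex, to be compared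
   with [w]. *)
have [aE|_] := eqVneq (par a) K'; last by apply: xw; case: (rooted_rt rG ab aK).
by rewrite -(rt_meet_root rG ab aK (v := w')) // aE.
Qed.

End EdgeForm.

(** * Extremal vectors of adjacency matrices and the comparison of spectral radii *)

Lemma row_form (R : realType) (n : nat) (G : sgraph 'I_n) (y : 'rV[R]_n) :
  (y *m adjmx R G *m y^T) 0 0 = edge_form G (y 0).
Proof.
rewrite mxE /edge_form exchange_big; apply: eq_bigr => j _.
rewrite !mxE mulr_suml; apply: eq_bigr => i _.
by rewrite !mxE mulrA [_ * y 0 i]mulrC.
Qed.

Lemma adjmx_sym (R : realType) (n : nat) (G : sgraph 'I_n) :
  (adjmx R G)^T = adjmx R G.
Proof. by apply/matrixP => i j; rewrite !mxE (adj_sym G). Qed.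

Lemma adjmx_rayleigh (R : realType) (n : nat) (G : sgraph 'I_n)
    (x : 'I_n -> R) :
  (0 < n)%N -> edge_form G x <= lambda1 (adjmx R G) * \sum_i x i ^+ 2.
Proof.
move=> n_gt0; have [_ /(_ (\row_i x i))] := lambda1_max n_gt0 (adjmx_sym R G).
rewrite row_form mxE (_ : edge_form G _ = edge_form G x); last first.
  by apply: eq_bigr => i _; apply: eq_bigr => j _; rewrite !mxE.
by under [X in _ * X]eq_bigr => i _ do rewrite !mxE -expr2.
Qed.

(* The entrywise absolute value of an eigenvector works because the adjacency
   matrix is nonnegative; this avoids the Perron-Frobenius theorem. *)
Lemma adjmx_nonneg_extremal (R : realType) (n : nat) (G : sgraph 'I_n) :
    (0 < n)%N ->
  exists x : 'I_n -> R, [/\ forall i, 0 <= x i, 0 < \sum_i x i ^+ 2 &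
    lambda1 (adjmx R G) * \sum_i x i ^+ 2 <= edge_form G x].
Proof.
move=> n_gt0.
have [/eigenvalueP[v vA v0] _] := lambda1_max n_gt0 (adjmx_sym R G).
have normE : \sum_i `|v 0 i| ^+ 2 = (v *m v^T) 0 0.
  rewrite mxE; apply: eq_bigr => i _.
  by rewrite mxE -expr2 real_normK ?num_real.
exists (fun i => `|v 0 i|); split=> [i| |] //.
  rewrite lt_neqAle sumr_ge0 ?andbT => [|i _]; last by rewrite exprn_ge0.
  apply: contraNneq v0 => /esym/eqP; rewrite psumr_eq0 => [/allP v0|i _];
    last first.
    by rewrite exprn_ge0.
  apply/eqP/rowP => i; have := v0 i; rewrite mem_index_enum => /(_ isT).
  by rewrite !mxE /= sqrf_eq0 normr_eq0 => /eqP.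
have := row_form G v; rewrite vA -scalemxAl mxE normE => ->.
apply: ler_sum => i _; apply: ler_sum => j _.
by rewrite ler_wpM2l ?ler0n // -normrM ler_norm.
Qed.

Theorem theorem2p2 (R : realType) (n s : nat) (CT : sgraph 'I_n)
    (CT_tree : clique_tree CT)
    (CT_cliques : #|blocks CT| = s)
    (CT_cut : exists u v : 'I_n,
        [/\ u \in cut_vertices CT, v \in cut_vertices CT, u != v
          & ~~ CT u v]) :
  exists w : 'I_n,
    (exists (w' : 'I_n) (K K' : {set 'I_n}), S_choice CT w w' K K') /\
    forall (w' : 'I_n) (K K' : {set 'I_n}) (S : sgraph 'I_n),
      S_choice CT w w' K K' -> is_S CT w w' K K' S ->
      lambda1 (adjmx R (compl CT)) <= lambda1 (adjmx R (compl S)).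
Proof.
have [u [v [ucut vcut uv _]]] := CT_cut.
have n_gt0 : (0 < n)%N by case: (n) u {uv ucut} => [[]|].
have [x [x0 xpos xmax]] := adjmx_nonneg_extremal R (compl CT) n_gt0.
(* The choice of [w] depends only on [x], so it precedes that of [w'], [K] and [K']. *)
have [w wcut wmin] : exists2 w, w \in cut_vertices CT &
    forall z, z \in cut_vertices CT -> x w <= x z.
  by case: (arg_minP x ucut) => w wcut wmin; exists w.
exists w; split.
  have [vw|vw] := eqVneq v w; last exact: S_choice_exists wcut vcut vw.
  by apply: (S_choice_exists CT_tree wcut ucut); rewrite -vw.
move=> w' K K' S Sch isS.
have [t tle] := edge_form_S_le CT_tree Sch isS x0 wmin.
rewrite -(ler_pM2r xpos); apply: le_trans xmax _.
(* The test vector for the complement of [S] is [x] relabelled by [t], with the same norm. *)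
have -> : \sum_i x i ^+ 2 = \sum_i (x \o (t^-1)%g) i ^+ 2.
  rewrite [RHS](reindex_inj (@perm_inj _ t)).
  by apply: eq_bigr => i _; rewrite /= permK.
apply: le_trans (adjmx_rayleigh _ _ n_gt0).
rewrite !edge_form_compl edge_form_perm.
(* What remains is the form of the complete graph, which relabelling preserves. *)
apply: lerB => //; rewrite -/(edge_form [rel i j | i != j] x).
rewrite -/(edge_form [rel i j | i != j] (x \o _)) edge_form_perm.
apply: ler_sum => i _; apply: ler_sum => j _.
by rewrite /= (inj_eq perm_inj).
Qed.
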